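(* Let $\boldsymbol\theta$ be a torsion-free directive sequence defined on an alphabet $\mathcal A$ (i.e. $\mathcal A_n=\mathcal A$ for all $n$), of height $h$. Then the pure base $\bar{\boldsymbol\theta}$ of $\boldsymbol\theta$ is torsion-free and has trivial height (height $1$), and $(X_{\boldsymbol\theta},\sigma)$ is topologically conjugate to $(X_{\bar{\boldsymbol\theta}}\times\{0,\dots,h-1\},T)$, where $$T(x,i)=\begin{cases}(x,i+1)&\text{if }0\le i<h-1,\\(\bar\sigma(x),0)&\text{if }i=h-1,\end{cases}$$ and $\bar\sigma$ denotes the left shift on $X_{\bar{\boldsymbol\theta}}$.
   Context: Alphabets are finite sets. A morphism $\theta:\mathcal A\to\mathcal B^+$ maps letters to non-empty words and is extended by concatenation to words and to $\mathcal A^{\mathbb Z}$ (with $\theta(x_0)$ starting at index $0$). $\sigma$ is the left shift. A directive sequence is a sequence $\boldsymbol\theta=(\theta^{(n)})_{n\ge 0}$ of morphisms $\theta^{(n)}:\mathcal A_{n+1}\to\mathcal A_n^+$. Put $\theta^{[n,N)}=\theta^{(n)}\circ\cdots\circ\theta^{(N-1)}$. $X^{(n)}_{\boldsymbol\theta}=X^{(n)}$ is the set of $x\in\mathcal A_n^{\mathbb Z}$ all of whose finite subwords are subwords of $\theta^{[n,N)}(a)$ for some $N>n$ and $a\in\mathcal A_N$; $X_{\boldsymbol\theta}=X^{(0)}_{\boldsymbol\theta}$. $\boldsymbol\theta$ is constant-length with length sequence $(q_n)$ if $|\theta^{(n)}(a)|=q_n$ for all $n$ and all $a\in\mathcal A_{n+1}$.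 $\boldsymbol\theta$ is torsion-free if it is constant-length with length sequence $(q_n)$, $q_n>1$ for infinitely many $n$, each $(X^{(n)}_{\boldsymbol\theta},\sigma)$ is minimal, $X^{(0)}_{\boldsymbol\theta}$ is aperiodic (contains no $\sigma$-periodic point), and every prime dividing some $q_k$ divides $q_n$ for infinitely many $n$. Height: if $\boldsymbol\theta$ is torsion-free and defined on alphabets of bounded size ($\sup_n|\mathcal A_n|<\infty$), its maximal equicontinuous factor is the rotation by $(1,1)$ on $\mathbb Z_{(q_n)}\times\mathbb Z/h\mathbb Z$ for some $h$ coprime to every $q_n$, where $\mathbb Z_{(q_n)}=\varprojlim\mathbb Z/(q_0\cdots q_{n-1})\mathbb Z$; this $h=h(\boldsymbol\theta)$ is the height of $\boldsymbol\theta$. Pure base: let $h$ be the height of $\boldsymbol\theta$. Fix a sequence $(u^{(n)})_{n\ge0}$ with $u^{(n)}\in X^{(n)}$ and $\theta^{(n)}(u^{(n+1)})=u^{(n)}$ for all $n$. Let $\mathcal W^{(n)}$ be the set of words of length $h$ appearing in $u^{(n)}$ at an index in $\{kh:k\ge0\}$, let $\mathcal B^{(n)}$ be an alphabet with a bijection $\bar\tau_n:\mathcal B^{(n)}\to\mathcal W^{(n)}$, and let $\tau_n=\bar\tau_n^{-1}$; both are extended to concatenations (of letters of $\mathcal B^{(n)}$, respectively of words of $\mathcal W^{(n)}$). Define $\bar\theta^{(n)}:\mathcal B^{(n+1)}\to(\mathcal B^{(n)})^{q_n}$ by $\bar\theta^{(n)}(b)=\tau_n(\theta^{(n)}(\bar\tau_{n+1}(b)))$.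 The directive sequence $\bar{\boldsymbol\theta}=(\bar\theta^{(n)})_{n\ge0}$ is the pure base of $\boldsymbol\theta$. *)

(* Defs.v *)
(* MathComp / MathComp-Analysis *)
From HB Require Import structures.
From mathcomp Require Import all_boot all_order all_algebra.
From mathcomp Require Import all_classical all_reals all_analysis.

Set Implicit Arguments.
Unset Strict Implicit.
Unset Printing Implicit Defensive.

Import Order.TTheory GRing.Theory Num.Theory.

Local Open Scope classical_set_scope.
Local Open Scope nat_scope.

(* A system lives on a subset X of an ambient space, with the subspace         *)
(* topology; the values of the maps outside X are irrelevant.                  *)

(* S is a homeomorphism of Y: Y is compact and, wherever this predicate is     *)
(* used, the ambient space is Hausdorff.                                       *)
Definition dynamical_system {V : topologicalType} (Y : set V) (S : V -> V) :=
  [/\ compact Y, Y !=set0, {within Y, continuous S} & set_bij Y Y S].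

Definition minimal {V : topologicalType} (Y : set V) (S : V -> V) :=
  Y !=set0 /\
  forall F : set V, closed F -> F `<=` Y -> S @` F = F -> F !=set0 -> F = Y.

Definition aperiodic {V : Type} (Y : set V) (S : V -> V) :=
  forall y p, Y y -> 0 < p -> iter p S y <> y.

Definition factor_map {U V : topologicalType} (X : set U) (T : U -> U)
    (Y : set V) (S : V -> V) (pi : U -> V) :=
  [/\ {within X, continuous pi}, pi @` X = Y &
      forall x, X x -> pi (T x) = S (pi x)].

Definition conjugate {U V : topologicalType} (X : set U) (T : U -> U)
    (Y : set V) (S : V -> V) :=
  exists (f : U -> V) (g : V -> U),
    [/\ {within X, continuous f} /\ {within Y, continuous g},
        f @` X `<=` Y /\ g @` Y `<=` X,
        (forall x, X x -> g (f x) = x),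
        (forall y, Y y -> f (g y) = y) &
        forall x, X x -> f (T x) = S (f x)].

(* S ^ n for n in Z, where S' is the inverse of S. *)
Definition zpower {V : Type} (S S' : V -> V) (n : int) : V -> V :=
  match n with
  | Posz m => iter m S
  | Negz m => iter m.+1 S'
  end.

Definition equicontinuous_system {V : uniformType} (Y : set V) (S : V -> V) :=
  exists S' : V -> V,
    (forall y, Y y -> [/\ Y (S' y), S (S' y) = y & S' (S y) = y]) /\
    forall E : set (V * V), entourage E -> exists2 D, entourage D &
      forall x y, Y x -> Y y -> D (x, y) ->
        forall n : int, E (zpower S S' n x, zpower S S' n y).

Definition equicontinuous_factor {U : topologicalType} {V : uniformType}
    (X : set U) (T : U -> U) (Y : set V) (S : V -> V) (pi : U -> V) :=
  [/\ hausdorff_space V, dynamical_system Y S, equicontinuous_system Y S &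
      factor_map X T Y S pi].

Definition max_equicontinuous_factor {U : topologicalType} {V : uniformType}
    (X : set U) (T : U -> U) (Y : set V) (S : V -> V) :=
  exists pi : U -> V,
    equicontinuous_factor X T Y S pi /\
    forall (W : uniformType) (Z : set W) (R : W -> W) (rho : U -> W),
      equicontinuous_factor X T Z R rho ->
      exists p : V -> W, factor_map Y S Z R p /\
        forall x, X x -> p (pi x) = rho x.

(* `ptws` is the product topology; the default one on arrows is uniform. *)
Definition fullshift (A : finType) : topologicalType :=
  {ptws int -> discrete_topology A}.

Definition sigma {A : finType} (x : fullshift A) : fullshift A :=
  fun i => x (i + 1)%R.

Definition subword {A : finType} (x : fullshift A) (i : int) (l : nat) : seq A :=
  [seq x (i + k%:Z)%R | k <- iota 0 l].

Definition morph_word {A B : Type} (th : A -> seq B) (w : seq A) : seq B :=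
  flatten [seq th a | a <- w].

(* y = th(x), with th(x_0) starting at index 0: th(x_0 ... x_{m-1}) is read in *)
(* y from index 0 on, and th(x_{-m} ... x_{-1}) is read up to index -1.        *)
Definition morph_image {A B : finType} (th : A -> seq B)
    (x : fullshift A) (y : fullshift B) :=
  forall m : nat,
    (let w := morph_word th (subword x 0%R m) in
     subword y 0%R (size w) = w) /\
    (let w := morph_word th (subword x (- m%:Z)%R m) in
     subword y (- (size w)%:Z)%R (size w) = w).

Definition dirseq (A : nat -> finType) := forall n, A n.+1 -> seq (A n).

Definition nonerasing (A : nat -> finType) (theta : dirseq A) :=
  forall n a, theta n a != [::].

(* theta_comp theta n k is theta^[n, n + k). *)
Fixpoint theta_comp (A : nat -> finType) (theta : dirseq A) (n k : nat) :
    A (k + n) -> seq (A n) :=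
  match k with
  | 0 => fun a => [:: a]
  | k'.+1 => fun a => morph_word (theta_comp theta (n := n) (k := k'))
                                 (theta (k' + n) a)
  end.

Definition shift_space (A : nat -> finType) (theta : dirseq A) (n : nat) :
    set (fullshift (A n)) :=
  [set x | forall i l, exists k (a : A (k + n)),
      0 < k /\ infix (subword x i l) (theta_comp theta a)].
Arguments shift_space {A} theta n _.

Definition constant_length (A : nat -> finType) (theta : dirseq A)
    (q : nat -> nat) :=
  forall n a, size (theta n a) = q n.

Definition torsion_free (A : nat -> finType) (theta : dirseq A) :=
  nonerasing theta /\
  exists q : nat -> nat,
    [/\ constant_length theta q,
        (forall N, exists2 n, N <= n & 1 < q n),
        (forall n, minimal (shift_space theta n) sigma),
        aperiodic (shift_space theta 0) sigma &
        forall p k, prime p -> p %| q k -> forall N, exists2 n, N <= n & p %| q n].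

Definition bounded_alphabets (A : nat -> finType) :=
  exists M, forall n, #|A n| <= M.

(* lim Z/(q_0 ... q_{n-1})Z, residues being represented in {0, ..., Q_n - 1}. *)
Definition qprod (q : nat -> nat) (n : nat) : nat := \prod_(i < n) q i.

Definition odometer (q : nat -> nat) : set {ptws nat -> nat} :=
  [set z | forall n, z n < qprod q n /\ z n.+1 %% qprod q n = z n].

Definition rotation_space (q : nat -> nat) (h : nat) :
    set ({ptws nat -> nat} * nat)%type :=
  odometer q `*` `I_h.

Definition rotation (q : nat -> nat) (h : nat)
    (z : ({ptws nat -> nat} * nat)%type) : ({ptws nat -> nat} * nat)%type :=
  ((fun n => (z.1 n).+1 %% qprod q n) : {ptws nat -> nat}, z.2.+1 %% h).

Definition is_height (A : nat -> finType) (theta : dirseq A) (h : nat) :=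
  [/\ torsion_free theta, bounded_alphabets A, 0 < h &
      exists q : nat -> nat,
        [/\ constant_length theta q,
            (forall n, coprime h (q n)) &
            max_equicontinuous_factor (shift_space theta 0) sigma
              (rotation_space q h) (rotation q h)]].

Definition block_words {A : finType} (h : nat) (x : fullshift A) : set (seq A) :=
  [set w | exists k : nat, w = subword x (k * h)%:Z h].

(* The inverse of a bijection taubar onto words of length h, extended to       *)
(* concatenations of such words.                                               *)
Definition tau {A B : finType} (h : nat) (taubar : B -> seq A) (w : seq A) :
    seq B :=
  pmap (fun v => [pick b | taubar b == v]) (reshape (nseq (size w %/ h) h) w).

Definition pure_base (A : nat -> finType) (theta : dirseq A) (h : nat)
    (B : nat -> finType) (taubar : forall n, B n -> seq (A n)) : dirseq B :=
  fun n b => tau h (@taubar n) (morph_word (@theta n) (taubar n.+1 b)).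

Definition tower {B : finType} (h : nat) (X : set (fullshift B)) :
    set (fullshift B * nat)%type :=
  X `*` `I_h.

Definition tower_map {B : finType} (h : nat) (z : (fullshift B * nat)%type) :
    (fullshift B * nat)%type :=
  if z.2 < h.-1 then (z.1, z.2.+1) else (sigma z.1, 0).

(* Main.v *)
(* Composing the projection of the maximal equicontinuous factor onto Z/h with
   the morphisms theta^[0,n) gives, because h is coprime to every q_n, a
   continuous "clock" X^(n) -> Z/h which sigma advances by 1.  Minimality of
   X^(n) then makes the forward sigma^h-orbit of u^(n) dense in the clopen set
   D^(n) of points with the same clock value as u^(n), so the words occurring in
   a point of D^(n) at the multiples of h are exactly the words of W^(n).  Hence
   reading blocks of length h conjugates (D^(n), sigma^h) to the n-th shift space
   of the pure base, which gives the minimality of the latter, and for n = 0 the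
   conjugacy with the tower.  On D^(0), sigma^h acts on the odometer as addition
   of h, an invertible multiple of 1, so the odometer is an equicontinuous factor
   of the pure base; it is the maximal one because every equicontinuous factor of
   the pure base suspends, with height h, to one of X. *)
Require Import Defs.
From HB Require Import structures.
From mathcomp Require Import all_boot all_order all_algebra.
From mathcomp Require Import all_classical all_reals all_analysis.
From mathcomp Require Import zify ring.

Set Implicit Arguments.
Unset Strict Implicit.
Unset Printing Implicit Defensive.

Import Order.TTheory GRing.Theory Num.Theory.

Local Open Scope classical_set_scope.
Local Open Scope nat_scope.

(** * Topology of full shifts *)

Lemma within_continuousP (U V : topologicalType) (X : set U) (f : U -> V) :
  {within X, continuous f} <->
  forall x, X x -> forall E, nbhs (f x) E -> \forall y \near x, X y -> E (f y).
Proof. exact: subspace_continuousP. Qed.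

Lemma continuous_within_comp (U V W : topologicalType) (X : set U) (Y : set V)
    (f : U -> V) (g : V -> W) :
  {within X, continuous f} -> {within Y, continuous g} -> f @` X `<=` Y ->
  {within X, continuous (g \o f)}.
Proof.
move=> /within_continuousP cf /within_continuousP cg fXY.
apply/within_continuousP => x Xx E nE.
have Yfx : Y (f x) by apply: fXY; exists x.
apply: filterS (cf x Xx _ (cg _ Yfx _ nE)) => y /= h Xy.
by apply: (h Xy); apply: fXY; exists y.
Qed.

Lemma nbhs_discreteE (K : discreteTopologicalType) (x : K) (E : set K) :
  nbhs x E <-> E x.
Proof. by rewrite nbhs_principalE; split=> /principal_filterP. Qed.

Lemma near_coord (I : eqType) (K : discreteTopologicalType) (i : I)
  (x : {ptws I -> K}) : \forall y \near x, y i = x i.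
Proof.
have := @proj_continuous I (fun=> K) i x [set x i]; apply.
exact/nbhs_discreteE.
Qed.

Lemma cvg_ptws_discrete (I : Type) (K : discreteTopologicalType) (T : Type)
    (F : set_system T) (FF : Filter F) (f : T -> {ptws I -> K})
    (y : {ptws I -> K}) :
  (forall i, \forall x \near F, f x i = y i) -> f @ F --> y.
Proof.
move=> H; apply/cvg_sup => i E [_ [[V oV <-] Vy EV]].
apply: filterS (H i) => x fxi; apply: EV.
by rewrite /= /proj fxi.
Qed.

Lemma near_seq_coords (A : finType) (x : fullshift A) (s : seq int) :
  \forall y \near x, {in s, forall i, y i = x i}.
Proof.
elim: s => [|i s IH]; first exact: (@filterE _ (nbhs x)).
apply: (@filterS2 _ (nbhs x) _ _ _ _ _ (near_coord i x) IH) => y yi ys j.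
rewrite inE => /orP[/eqP->//|].
exact: ys.
Qed.

Definition shz (A : finType) (j : int) (x : fullshift A) : fullshift A :=
  fun i => x (i + j)%R.

Lemma shz_continuous (A : finType) j : continuous (@shz A j).
Proof.
move=> x; apply: (@cvg_ptws_discrete _ _ _ (nbhs x)) => i.
exact: near_coord.
Qed.

Lemma shz0 (A : finType) (x : fullshift A) : shz 0 x = x.
Proof. by apply/funext => i; rewrite /shz addr0. Qed.

Lemma shzD (A : finType) (x : fullshift A) i j : shz i (shz j x) = shz (i + j) x.
Proof. by apply/funext => k; rewrite /shz addrA. Qed.

Lemma sigmaE (A : finType) : @sigma A = shz 1.
Proof. by []. Qed.

Lemma iter_sigma (A : finType) (x : fullshift A) n : iter n sigma x = shz n x.
Proof.
elim: n => [|n IH]; first by rewrite shz0.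
by rewrite iterS IH sigmaE shzD; congr shz; lia.
Qed.

Lemma fullshift_compact (A : finType) : compact [set: fullshift A].
Proof.
have := @tychonoff int (fun=> discrete_topology A) (fun=> setT).
have -> : [set f : int -> discrete_topology A |
    forall i, [set: discrete_topology A] (f i)] = setT.
  by apply/seteqP; split.
by apply=> _; apply: finite_compact; exact: (@finite_finset A).
Qed.

(** Inside the closure of a forward orbit, compactness produces a non-empty closed set that [sigma]
    maps onto itself. Minimality makes it all of [X]. *)
Lemma dense_orbit (A : finType) (X : set (fullshift A)) (x y : fullshift A) U :
  closed X -> minimal X sigma -> (forall z, X z -> X (sigma z)) ->
  X x -> X y -> nbhs y U -> exists k : nat, U (shz k x).
Proof.
move=> clX [_ minX] sX Xx Xy nU.
pose O := [set shz k%:Z x | k in [set: nat]]; pose M := closure O.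
have sM z : M z -> M (shz 1 z).
  move=> Mz V nV; have [_ [[k _ <-] Vk]] := Mz _ (@shz_continuous A 1 z _ nV).
  exists (shz k.+1 x); split; first by exists k.+1.
  by move: Vk; rewrite /= shzD (_ : 1 + k%:Z = k.+1)%R//; lia.
have MX : M `<=` X.
  rewrite [X in _ `<=` X](closure_id X).1//; apply: closure_subset => _ [k _ <-].
  rewrite -iter_sigma; elim: k => [//|k IH]; rewrite iterS; exact: sX.
have pc j : closed (@shz A j @^-1` M).
  apply: preimage_closed; last exact: closed_closure.
  by move=> z _; exact: shz_continuous.
(* [minimal] speaks about sets with [sigma @` F = F], whereas [M] is only
   forward invariant; [N] is its largest invariant subset. *)
pose N := [set z | forall k : nat, M (shz (- k%:Z) z)].
have NE : N = X.
  apply: minX.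
  - rewrite (_ : N = \bigcap_(k in [set: nat]) (shz (- k%:Z)) @^-1` M); last first.
      by apply/seteqP; split=> [z Nz k _|z Nz k]; [exact: Nz | exact: Nz k I].
    by apply: closed_bigI => k _.
  - by move=> z /(_ 0%N); rewrite oppr0 shz0; exact: MX.
  - apply/seteqP; split=> [_ [z Nz <-] [|k]|z Nz].
    + by rewrite oppr0 shz0; apply: sM; have := Nz 0%N; rewrite oppr0 shz0.
    + by rewrite sigmaE shzD (_ : - k.+1%:Z + 1 = - k%:Z)%R//; lia.
    + exists (shz (-1) z); last by rewrite sigmaE shzD subrr shz0.
      by move=> k; have := Nz k.+1; rewrite shzD (_ : - k.+1%:Z = - k%:Z + -1)%R//; lia.
  (* [N] is non-empty: it contains any cluster point of the forward orbit, because a fixed backward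
     shift of a late orbit point is still on the forward orbit. *)
  - have [//|z [_ clz]] := @fullshift_compact A ((fun k : nat => shz k%:Z x) @ \oo) _.
      exact: filterT.
    exists z => k.
    apply: (pc (- k%:Z)%R) => V nV; apply: (clz _ _ _ nV).
    exists k => // j /= kj; rewrite /= shzD; apply: subset_closure.
    by exists (j - k)%N => //; congr (shz _ x); lia.
have /(_ 0%N) : N y by rewrite NE.
by rewrite oppr0 shz0 => /(_ _ nU) [_ [[k _ <-] Uk]]; exists k.
Qed.

(** * Words and block maps *)

Section Subwords.
Variable A : finType.
Implicit Types (x y : fullshift A) (i j : int) (l m : nat).

Lemma size_subword x i l : size (subword x i l) = l.
Proof. by rewrite size_map size_iota. Qed.

Lemma nth_subword a0 x i l r : r < l -> nth a0 (subword x i l) r = x (i + r%:Z)%R.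
Proof. by move=> rl; rewrite (nth_map 0) ?size_iota// nth_iota. Qed.

Lemma subword_shz x i j l : subword (shz j x) i l = subword x (i + j)%R l.
Proof. by apply: eq_map => k; rewrite /shz; congr x; lia. Qed.

Lemma subword_cat x i l m :
  subword x i (l + m) = subword x i l ++ subword x (i + l%:Z)%R m.
Proof.
rewrite /subword iotaD map_cat; congr (_ ++ _).
rewrite -[in LHS](addn0 (0 + l)) iotaDl -map_comp; apply: eq_map => k /=.
by congr x; lia.
Qed.

Lemma subword_infix x i j l m : (i <= j)%R -> (j + m%:Z <= i + l%:Z)%R ->
  infix (subword x j m) (subword x i l).
Proof.
move=> ij jm.
have -> : l = `|j - i|%N + (m + (l - (`|j - i|%N + m))) by lia.
rewrite !subword_cat (_ : (i + `|j - i|%N)%R = j); last lia.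
by apply/infixP; exists (subword x i `|j - i|),
  (subword x (j + m%:Z)%R (l - (`|j - i|%N + m))).
Qed.

Lemma eq_subwordP x y i j l :
  subword x i l = subword y j l <->
  (forall r : nat, r < l -> x (i + r%:Z)%R = y (j + r%:Z)%R).
Proof.
split=> [E r rl|E].
  by rewrite -(nth_subword (x 0%R) x _ rl) E nth_subword.
apply: (@eq_from_nth _ (x 0%R)); rewrite !size_subword// => r rl.
by rewrite !nth_subword// E.
Qed.

Lemma near_subword x i l : \forall y \near x, subword y i l = subword x i l.
Proof.
apply: (@filterS _ (nbhs x) _ _ _ _
  (near_seq_coords x [seq (i + k%:Z)%R | k <- iota 0 l])).
by move=> y Ey; apply/eq_in_map => k kl; apply: Ey; apply: map_f.
Qed.

End Subwords.

(** * Morphisms on finite words *)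

Section MorphWord.
Variables A B : Type.

Lemma morph_word_cat (f : A -> seq B) v w :
  morph_word f (v ++ w) = morph_word f v ++ morph_word f w.
Proof. by rewrite /morph_word map_cat flatten_cat. Qed.

Lemma morph_word1 (f : A -> seq B) a : morph_word f [:: a] = f a.
Proof. by rewrite /morph_word /= cats0. Qed.

Lemma eq_morph_word (f g : A -> seq B) : f =1 g -> morph_word f =1 morph_word g.
Proof. by move=> fg w; rewrite /morph_word (eq_map fg). Qed.

Lemma size_morph_word (f : A -> seq B) h w :
  (forall a, size (f a) = h) -> size (morph_word f w) = size w * h.
Proof.
move=> fh; elim: w => [//|a w IH].
by rewrite -cat1s morph_word_cat size_cat IH morph_word1 fh size_cat mulnDl mul1n.
Qed.

Lemma morph_word_inj (f : A -> seq B) h :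
  0 < h -> (forall a, size (f a) = h) -> injective f -> injective (morph_word f).
Proof.
move=> h0 fh finj; elim=> [|a v IH] [|b w] //; rewrite ?/morph_word /=.
- by move=> /(congr1 size); rewrite size_cat fh /=; lia.
- by move=> /(congr1 size); rewrite size_cat fh /=; lia.
- move=> E; have := congr1 (take h) E; have := congr1 (drop h) E.
  rewrite !drop_size_cat ?fh// !take_size_cat ?fh// => /IH -> /finj -> //.
Qed.

End MorphWord.

Lemma morph_word_comp (A B C : Type) (f : B -> seq C) (g : A -> seq B) w :
  morph_word f (morph_word g w) = morph_word (fun a => morph_word f (g a)) w.
Proof.
elim: w => [//|a w IH].
have -> : morph_word g (a :: w) = g a ++ morph_word g w by [].
by rewrite morph_word_cat IH.
Qed.

Lemma infix_morph_word (A B : eqType) (f : A -> seq B) v w :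
  infix v w -> infix (morph_word f v) (morph_word f w).
Proof.
move=> /infixP[p [s ->]]; rewrite !morph_word_cat.
by apply/infixP; eexists; eexists.
Qed.

Lemma infix_subword (A : finType) (x : fullshift A) i l w : infix w (subword x i l) ->
  exists2 k : nat, k + size w <= l & w = subword x (i + k%:Z)%R (size w).
Proof.
move=> /infixP[p [s E]]; exists (size p).
  by have := congr1 size E; rewrite !size_cat size_subword; lia.
have sE : l = size p + (size w + size s).
  by rewrite -[l](size_subword x i) E !size_cat.
have := congr1 (fun s => take (size w) (drop (size p) s)) E.
rewrite {1}sE !subword_cat !drop_size_cat ?size_subword//.
by rewrite !take_size_cat ?size_subword.
Qed.

(** The bi-infinite extension of a morphism [t] of constant length [h], with t(y_0) starting at
    index 0. It serves both for the morphisms theta^(n) and for [taubar]. The default [a0] is never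
    read when the words have length [h > 0]. *)
Definition blk (A B : finType) (a0 : A) (h : nat) (t : B -> seq A)
    (y : fullshift B) : fullshift A :=
  fun i => nth a0 (t (y (i %/ h)%Z)) `|(i %% h)%Z|%N.

Section BlockMap.
Variables (A B : finType) (a0 : A) (h : nat) (t : B -> seq A).
Hypotheses (h0 : 0 < h) (th : forall b, size (t b) = h).
Local Notation G := (blk a0 h t).

Lemma blkE y (k : int) (r : nat) : r < h ->
  G y (k * h%:Z + r%:Z)%R = nth a0 (t (y k)) r.
Proof.
move=> rh; rewrite /blk divzMDl; last by rewrite eqz_nat -lt0n.
by rewrite divz_small ?addr0 ?modzMDl ?modz_small//; rewrite ?ltz_nat ?lez_nat.
Qed.

Lemma block_index (i : int) : exists (k : int) (r : nat),
  r < h /\ (i = k * h%:Z + r%:Z)%R.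
Proof.
exists (i %/ h)%Z, `|(i %% h)%Z|%N.
have h1 : (h%:Z != 0)%R by rewrite eqz_nat -lt0n.
have h2 : (0 < h%:Z)%R by lia.
have m0 := modz_ge0 i h1; have := ltz_pmod i h2.
by rewrite gez0_abs// -divz_eq; split=> //; lia.
Qed.

Lemma blk_continuous : continuous G.
Proof.
move=> y; apply: (@cvg_ptws_discrete _ _ _ (nbhs y)) => i.
have := near_coord (i %/ h)%Z y.
by apply: (@filterS _ (nbhs y)) => z; rewrite /blk => ->.
Qed.

Lemma subword_blk y k m :
  subword (G y) (k * h%:Z)%R (m * h) = morph_word t (subword y k m).
Proof.
elim: m => [//|m IH].
rewrite mulSn addnC -addn1 !subword_cat morph_word_cat IH; congr (_ ++ _).
rewrite (_ : subword y _ 1 = [:: y (k + m%:Z)%R]); last by rewrite /subword /= addr0.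
rewrite morph_word1; apply: (@eq_from_nth _ a0); rewrite ?size_subword// => r rh.
rewrite nth_subword// -blkE//; congr (G y); rewrite PoszM; ring.
Qed.

Lemma blk_shz y (j : int) : G (shz j y) = shz (j * h%:Z)%R (G y).
Proof.
apply/funext => i; have [k [r [rh ->]]] := block_index i.
rewrite blkE// /shz -(blkE y (k + j)%R rh); congr (G y); ring.
Qed.

End BlockMap.

(** * Shift spaces and clocks *)

Section ShiftSpace.
Variables (A : nat -> finType) (theta : dirseq A).

Lemma shift_space_closed n : closed (shift_space theta n).
Proof.
move=> x clx i l.
have [y [Xy Ey]] := clx _ (near_subword x i l).
by have := Xy i l; rewrite Ey.
Qed.

Lemma shift_space_shz n j x : shift_space theta n x -> shift_space theta n (shz j x).
Proof. by move=> Xx i l; rewrite subword_shz; exact: Xx. Qed.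

End ShiftSpace.

(** The definition of [theta_comp] peels off the innermost morphism, whereas passing from level n+1
    to level n needs the outermost one. The constant alphabet spares a cast between [k + n.+1] and
    [k.+1 + n]. *)
Lemma theta_comp_recl (A : finType) (theta : dirseq (fun=> A)) n k (a : A) :
  @theta_comp _ theta n k.+1 a = morph_word (@theta n) (@theta_comp _ theta n.+1 k a).
Proof.
elim: k a => [|k IH] a; first exact: etrans (flatten_seq1 _) (esym (cats0 _)).
rewrite [RHS]/= morph_word_comp [LHS]/= addnS.
exact: eq_morph_word.
Qed.

(** * Sequences of points generated by the morphisms *)

Section Generating.
Variables (A : nat -> finType) (a0 : forall n, A n) (theta : dirseq A).
Variables (q : nat -> nat) (u : forall n, fullshift (A n)).
Hypotheses (q0 : forall n, 0 < q n) (thq : constant_length theta q).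
Local Notation Theta n := (blk (a0 n) (q n) (@theta n)).

(** Image blocks have length at least 1, so [|i| + 1] of them on either side of the origin reach
    index [i]; the finite windows therefore determine [y]. *)
Lemma morph_imageE n x y : morph_image (@theta n) x y -> y = Theta n x.
Proof.
move=> im; apply/funext => i; have [im1 im2] := im `|i|.+1.
have r0 := q0 n.
have [i0|i0] := lerP 0 i.
- move: im1; rewrite /= (size_morph_word _ (@thq n)) size_subword.
  rewrite -(subword_blk (a0 n) (q0 n) (@thq n)) mul0r => /eq_subwordP /(_ `|i|%N).
  by rewrite !add0r gez0_abs//; apply; nia.
- move: im2; rewrite /= (size_morph_word _ (@thq n)) size_subword.
  rewrite -(subword_blk (a0 n) (q0 n) (@thq n)) mulNr -PoszM.
  move=> /eq_subwordP /(_ (`|i|.+1 * q n - `|i|)).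
  rewrite (_ : (- (`|i|.+1 * q n)%:Z + (`|i|.+1 * q n - `|i|)%:Z = i)%R); last nia.
  by apply; nia.
Qed.

(** Iterating the fixed-point relation locates the image of a window of level [k + n] inside [u n].
    Applied to the pure base, it identifies the words theta^[n,n+k)(b) with windows of one point. *)
Lemma morph_theta_comp n k (j l : nat) :
  (forall n, u n = Theta n (u n.+1)) ->
  let Q := \prod_(i < k) q (i + n) in
  morph_word (@theta_comp _ theta n k) (subword (u (k + n)) j l) =
  subword (u n) (j * Q)%:Z (l * Q).
Proof.
move=> uf; elim: k j l => [|k IH] j l /=.
  by rewrite big_ord0 !muln1; exact: flatten_seq1.
have -> : subword (u (k.+1 + n)) j l = subword (u (k + n).+1) j l by [].
rewrite -(morph_word_comp (@theta_comp _ theta n k)).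
rewrite -(subword_blk (a0 _) (q0 _) (@thq _)) -uf -PoszM IH.
by rewrite big_ord_recr /= -!mulnA (mulnC (q _)).
Qed.

End Generating.

Lemma shift_space_blk (A : finType) (a0 : A) (theta : dirseq (fun=> A)) q n x :
  (forall n, 0 < q n) -> constant_length theta q ->
  shift_space theta n.+1 x -> shift_space theta n (blk a0 (q n) (@theta n) x).
Proof.
(* The images of [m] letters on each side of the origin cover the window, since every image is
   non-empty. *)
move=> q0 thq Xx i l; pose m := `|i|%N + l.
have [k [a [k0 inf]]] := Xx (- m%:Z)%R (m + m).
exists k.+1, a; split=> //; rewrite theta_comp_recl.
apply: infix_trans (infix_morph_word (@theta n) inf).
rewrite -(subword_blk a0 (q0 n) (@thq n)).
have := q0 n; move: (q n) => r r0.
by apply: subword_infix; rewrite /m; nia.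
Qed.

(** Each further factor [q n > 1] at least doubles the product, while the other factors never
    decrease it. *)
Lemma prod_unbounded (q : nat -> nat) n L :
  (forall n, 0 < q n) -> (forall N, exists2 n, N <= n & 1 < q n) ->
  exists2 k, 0 < k & L < \prod_(i < k) q (i + n).
Proof.
move=> q0 q1.
have mono k d : \prod_(i < k) q (i + n) <= \prod_(i < d + k) q (i + n).
  elim: d => [//|d IH]; rewrite big_ord_recr /=.
  by apply: leq_trans IH _; rewrite leq_pmulr.
elim: L => [|L [k k0 IH]]; first by exists 1; rewrite // big_ord1.
have [n' kn q2] := q1 (k + n); exists (n' - n).+1 => //.
rewrite big_ord_recr /= subnK; last by lia.
have := mono k (n' - n - k); rewrite (_ : n' - n - k + k = n' - n); last by lia.
by move=> mk; apply: leq_trans (leq_mul (leq_trans IH mk) q2); lia.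
Qed.

Lemma modn_inverse (h q : nat) : 0 < q -> coprime h q ->
  exists r, r * q = 1 %[mod h].
Proof.
move=> q0 hq; case: (egcdnP h q0) => km kn E _; exists km.
by rewrite E gcdnC (eqP hq) modnMDl.
Qed.

(** A continuous equivariant map from [X] to the rotation by 1 on Z/h, with residues taken in 0,
    ..., h-1; continuity into a discrete space is local constancy. *)
Definition clock (A : finType) (h : nat) (X : set (fullshift A))
    (c : fullshift A -> nat) :=
  forall x, X x -> [/\ c x < h, (\forall y \near x, X y -> c y = c x) &
                       c (sigma x) = (c x).+1 %% h].

(** * Clock arithmetic and density of forward orbits under the h-th power of the shift *)

Section Clock.
Variables (A : finType) (h : nat) (X : set (fullshift A)) (c : fullshift A -> nat).
Hypotheses (shX : forall j x, X x -> X (shz j x)) (cX : clock h X c).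

Lemma clock_shz_nat (k : nat) x : X x -> c (shz k%:Z x) = (c x + k) %% h.
Proof.
move=> Xx; elim: k => [|k IH].
  by rewrite shz0 addn0 modn_small//; have [] := cX Xx.
have -> : shz k.+1 x = sigma (shz k x) by rewrite sigmaE shzD; congr (shz _ x); lia.
have [_ _ ->] := cX (shX k Xx); rewrite IH.
by rewrite -[(_ %% h).+1]addn1 modnDml addn1 addnS.
Qed.

Lemma clock_shz_mul (k : int) x : X x -> c (shz (k * h%:Z)%R x) = c x.
Proof.
move=> Xx; have ch z : X z -> c z < h by move=> /cX[].
case: k => k.
  by rewrite -PoszM clock_shz_nat// addnC modnMDl modn_small// ch.
(* For negative [k], [x] is a forward shift of the other point by a multiple of [h], so the forward
   formula applies. *)
have E : x = shz (k.+1 * h)%:Z (shz (Negz k * h%:Z)%R x).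
  by rewrite shzD -[LHS]shz0; congr (shz _ x); rewrite NegzE PoszM; ring.
have Xk := shX (Negz k * h%:Z)%R Xx.
by rewrite {2}E (clock_shz_nat _ Xk) addnC modnMDl modn_small// ch.
Qed.

Lemma clock_dense x y U : closed X -> minimal X sigma -> X x -> X y ->
  c x = c y -> nbhs y U -> exists k : nat, U (shz (k%:Z * h%:Z)%R x).
Proof.
move=> clX mX Xx Xy cxy nU; have [cy nc _] := cX Xy.
(* The neighbourhood is cut down to one where the clock equals [c y]; reaching it in time [k] forces
   [k] to be a multiple of [h]. *)
have [k [Uk ck]] := dense_orbit clX mX (shX 1%R) Xx Xy (filterI nU nc).
exists (k %/ h); have := ck (shX k Xx); rewrite clock_shz_nat// cxy => E.
have /dvdnP[k' kE] : h %| k.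
  have : c y + k = c y + 0 %[mod h] by rewrite E addn0 modn_small.
  by move/eqP; rewrite eqn_modDl mod0n.
have h0 : 0 < h by exact: leq_ltn_trans cy.
by rewrite kE mulnK// -PoszM -kE.
Qed.

End Clock.

(** One shift of [y] is [q] shifts of its image, so the pulled-back clock advances by [q];
    multiplying by the inverse [r] of [q] modulo [h] renormalises the step to 1. *)
Lemma clock_blk (A B : finType) (a0 : A) (h q : nat) (t : B -> seq A)
    (X : set (fullshift A)) (Y : set (fullshift B)) c :
  0 < h -> 0 < q -> coprime h q -> (forall b, size (t b) = q) ->
  (forall j x, X x -> X (shz j x)) -> (forall y, Y y -> X (blk a0 q t y)) ->
  clock h X c -> exists d, clock h Y d.
Proof.
move=> h0 q0 hq tq shX YX cX; have [r rq] := modn_inverse q0 hq.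
exists (fun y => (r * c (blk a0 q t y)) %% h) => y Yy.
have Xy := YX _ Yy; have [cy nc _] := cX _ Xy; split.
- by rewrite ltn_mod.
- have := @blk_continuous _ _ a0 q t y _ nc; apply: (@filterS _ (nbhs y)) => z /= E Yz.
  by rewrite E//; exact: YX.
- rewrite sigmaE (blk_shz a0 t q0) mul1r (clock_shz_nat shX cX)//.
  by rewrite modnMmr mulnDr -modnDmr rq modnDmr -modnDml addn1.
Qed.

(** * The clopen set D^(n) *)

(** The inverse of [blk] on sequences cut into admissible blocks. The default [b0] makes it total,
    hence continuous on the whole full shift. *)
Definition unblk (A B : finType) (b0 : B) (h : nat) (t : B -> seq A)
    (x : fullshift A) : fullshift B :=
  fun k => odflt b0 [pick b | t b == subword x (k * h%:Z)%R h].

Section Unblock.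
Variables (A B : finType) (a0 : A) (b0 : B) (h : nat) (t : B -> seq A).
Hypotheses (h0 : 0 < h) (th : forall b, size (t b) = h) (tinj : injective t).
Local Notation G := (blk a0 h t).
Local Notation F := (unblk b0 h t).

Definition block_range (x : fullshift A) :=
  forall k : int, exists b, t b = subword x (k * h%:Z)%R h.

Lemma unblk_continuous : continuous F.
Proof.
move=> x; apply: (@cvg_ptws_discrete _ _ _ (nbhs x)) => k.
have := near_subword x (k * h%:Z)%R h.
by apply: (@filterS _ (nbhs x)) => z; rewrite /unblk => ->.
Qed.

Lemma unblkE x k b : t b = subword x (k * h%:Z)%R h -> F x k = b.
Proof.
move=> tb; rewrite /unblk; case: pickP => [b' /eqP|/(_ b)]; last by rewrite tb eqxx.
by rewrite -tb => /tinj.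
Qed.

Lemma blkK : cancel G F.
Proof.
move=> y; apply/funext => k; apply: unblkE.
have := subword_blk a0 h0 th y k 1; rewrite mul1n => ->.
by rewrite /subword /= addr0 morph_word1.
Qed.

Lemma unblkK x : block_range x -> G (F x) = x.
Proof.
move=> bx; apply/funext => i; have [k [r [rh ->]]] := block_index h0 i.
rewrite blkE//; have [b tb] := bx k.
by rewrite (unblkE tb) tb nth_subword.
Qed.

(** Links [tau], which cuts finite words in the definition of the pure base, to [unblk]. Under
    [block_range] no piece is dropped by the [pmap]. *)
Lemma tau_subword x (k : int) (m : nat) : block_range x ->
  tau h t (subword x (k * h%:Z)%R (m * h)) = subword (F x) k m.
Proof.
move=> bx; rewrite /tau size_subword mulnK//.
elim: m k => [//|m IH] k; rewrite /= mulSn subword_cat.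
rewrite take_size_cat ?drop_size_cat ?size_subword//.
rewrite (_ : k * h%:Z + h%:Z = (k + 1) * h%:Z)%R; last by ring.
have [b tb] := bx k; rewrite IH.
case: pickP => [b' /eqP tb'|/(_ b)]; last by rewrite tb eqxx.
rewrite /= -[m.+1]add1n subword_cat /subword /= addr0.
by rewrite (unblkE tb').
Qed.

End Unblock.

Section Level.
Variables (A B : finType) (a0 : A) (b0 : B) (h : nat) (t : B -> seq A).
Variables (X : set (fullshift A)) (c : fullshift A -> nat) (u : fullshift A).
Hypotheses (h0 : 0 < h) (clX : closed X) (mX : minimal X sigma).
Hypotheses (shX : forall j x, X x -> X (shz j x)) (cX : clock h X c) (Xu : X u).
Hypothesis t_bij : set_bij [set: B] (block_words h u) t.
Local Notation G := (blk a0 h t).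
Local Notation F := (unblk b0 h t).

Lemma size_block b : size (t b) = h.
Proof.
by have [/(_ b I) [k ->] _ _] := t_bij; rewrite size_subword.
Qed.

Lemma block_inj : injective t.
Proof. by have [_ ti _] := t_bij; move=> b b'; apply: ti; rewrite inE. Qed.

(* D^(n) when [X] is X^(n) and [u] is u^(n). *)
Definition base : set (fullshift A) := [set x | X x /\ c x = c u].

Lemma base_shz k x : base x -> base (shz (k * h%:Z)%R x).
Proof. by move=> [Xx cx]; split; [exact: shX|rewrite (clock_shz_mul shX cX)]. Qed.

Lemma base_block_range x : base x -> block_range h t x.
Proof.
move=> bx k; have [Xy cy] := base_shz k bx.
(* The block, moved to the origin, starts a point with the clock value of [u], so it recurs in [u]
   at a multiple of [h]. *)
have := clock_dense shX cX clX mX Xu Xy (esym cy) (near_subword _ 0%R h).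
move=> [j]; rewrite !subword_shz !add0r => E.
have [_ _ /(_ (subword x (k * h%:Z)%R h))] := t_bij; case.
  by exists j; rewrite -E PoszM.
by move=> b _ tb; exists b.
Qed.

(* The forward [sigma^h]-orbit of [u] stays in the clopen set [base], which is
   why it suffices to approximate [G y] along that orbit. *)
Lemma base_blk_limit y :
  (forall m : nat, exists k : nat,
     subword (G y) (- (m * h)%:Z)%R (m.*2 * h) =
     subword u (k * h)%:Z (m.*2 * h)) -> base (G y).
Proof.
move=> /choice[k Ek].
(* The extra [m] recentres the window found at [k m * h], so that [v m] agrees with [G y] from
   [- m * h] up to [m * h]. *)
pose v m := shz ((k m + m)%N%:Z * h%:Z)%R u.
have bv m : base (v m) by exact: base_shz.
have cv : v @ \oo --> (G y).
  apply: cvg_ptws_discrete => i; exists `|i|.+1 => // m /= im.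
  have := (eq_subwordP _ _ _ _ _).1 (Ek m) `|(i + (m * h)%N)%R|%N.
  have [h1 m1] : (`|i| < m) /\ m <= m * h by rewrite leq_pmulr.
  have ge0 : (0 <= i + (m * h)%N)%R by lia.
  rewrite gez0_abs// -addnn => E; rewrite /v /shz.
  have -> : (i + (k m + m)%N%:Z * h%:Z = (k m * h)%N%:Z + (i + (m * h)%N%:Z))%R.
    by rewrite !PoszM PoszD; ring.
  rewrite -E; last by rewrite mulnDl; lia.
  by congr (G y); ring.
have XGy : X (G y).
  apply: (closed_cvg _ clX _ _ cv); apply: nearW => m; exact: (bv m).1.
split=> //; have [_ nc _] := cX XGy.
have [N _ /(_ N (leqnn N)) /= E] := cv _ nc.
by rewrite -E; [exact: (bv N).2|exact: (bv N).1].
Qed.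

Lemma base_dense x y l : base x -> base y ->
  exists k : nat, subword x (k * h)%:Z l = subword y 0%R l.
Proof.
move=> [Xx cx] [Xy cy].
have := clock_dense shX cX clX mX Xx Xy _ (near_subword y 0%R l).
rewrite cx cy => /(_ erefl) [k]; rewrite subword_shz add0r => E.
by exists k; rewrite PoszM.
Qed.

(** [blk] turns [sigma] into its h-th power, whose forward orbits are dense in [base]; the
    continuous inverse [unblk] carries this density back to [Y]. *)
Lemma unblk_dense (Y : set (fullshift B)) y z U :
  (forall y, Y y -> base (G y)) -> Y y -> Y z -> nbhs z U ->
  exists k : nat, U (shz k y).
Proof.
move=> YG Yy Yz nU; have [Xy cy] := YG _ Yy; have [Xz cz] := YG _ Yz.
have nU' : nbhs (F (G z)) U by rewrite (blkK a0 b0 h0 size_block block_inj).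
have := clock_dense shX cX clX mX Xy Xz _ (@unblk_continuous _ _ b0 h t _ _ nU').
rewrite cy cz => /(_ erefl)[k] /=.
rewrite -(blk_shz a0 t h0) (blkK a0 b0 h0 size_block block_inj) => Uk.
by exists k.
Qed.

End Level.

Lemma minimal_of_dense (A : finType) (Y : set (fullshift A)) :
  Y !=set0 ->
  (forall y z U, Y y -> Y z -> nbhs z U -> exists k : nat, U (shz k y)) ->
  minimal Y sigma.
Proof.
move=> Y0 dY; split=> // K clK KY sK [y Ky]; apply/seteqP; split=> // z Yz.
apply: clK => U nU; have [k Uk] := dY y z U (KY _ Ky) Yz nU.
exists (shz k y); split=> //; rewrite -iter_sigma.
by elim: k {Uk} => [//|k IH]; rewrite -sK; exists (iter k sigma y).
Qed.

(** * The pure base *)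

Section PureBase.
Variables (A : finType) (theta : dirseq (fun=> A)) (h : nat) (q : nat -> nat).
Variables (u : nat -> fullshift A) (B : nat -> finType).
Variables (taubar : forall n, B n -> seq A).
Hypotheses (h0 : 0 < h) (q0 : forall n, 0 < q n) (thq : constant_length theta q).
Hypotheses (hq : forall n, coprime h (q n)).
Hypothesis q1 : forall N, exists2 n, N <= n & 1 < q n.
Hypothesis mX : forall n, minimal (shift_space theta n) sigma.
Hypothesis u_mem : forall n, shift_space theta n (u n).
Hypothesis u_fix : forall n, morph_image (@theta n) (u n.+1) (u n).
Hypothesis taubar_bij : forall n,
  set_bij [set: B n] (block_words h (u n)) (@taubar n).
Hypothesis clock0 : exists c, clock h (shift_space theta 0) c.

Local Notation a0 := (u 0 0%R).
Local Notation thetabar := (pure_base theta h taubar).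
Local Notation X n := (shift_space theta n).
Local Notation Xbar n := (shift_space thetabar n).
Local Notation G n := (blk a0 h (@taubar n)).

(** Lifts [clock0] one level at a time, as theta^(n) maps X^(n+1) into X^(n). *)
Lemma clock_exists n : exists c, clock h (X n) c.
Proof.
elim: n => [//|n [c cX]].
apply: (@clock_blk _ _ a0 h (q n) (@theta n) (X n) (X n.+1) c) => //.
- by move=> j x; exact: shift_space_shz.
- by move=> y; exact: shift_space_blk.
Qed.

Lemma size_taubar n (b : B n) : size (taubar b) = h.
Proof. exact: size_block (taubar_bij n) b. Qed.

Lemma taubar_inj n : injective (@taubar n).
Proof. exact: block_inj (taubar_bij n). Qed.

Lemma block_exists n : exists b : B n, taubar b = subword (u n) 0%R h.
Proof.
have [_ _ /(_ (subword (u n) 0%R h))] := taubar_bij n; case; first by exists 0.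
by move=> b _ tb; exists b.
Qed.

Definition b0 n : B n := projT1 (cid (block_exists n)).
Local Notation F n := (unblk (b0 n) h (@taubar n)).

(** The analogue of [u n] for the pure base: it is fixed by the morphisms of [thetabar] and every
    letter of [B n] occurs in it. *)
Definition ubar n : fullshift (B n) := F n (u n).

Lemma ubarE n k b : taubar b = subword (u n) (k * h%:Z)%R h -> ubar n k = b.
Proof. exact: (unblkE _ (@taubar_inj n)). Qed.

Lemma u_block_range n : block_range h (@taubar n) (u n).
Proof.
have [c cX] := clock_exists n.
apply: (base_block_range (@shift_space_closed _ theta n) (mX n)
  (@shift_space_shz _ theta n) cX (u_mem n) (taubar_bij n)).
by split.
Qed.

(** The k-th block of [u n.+1] has its image in [u n] at index [k * h * q n]. This is again a
    multiple of [h], so the image is cut into blocks exactly where [ubar n] reads them. *)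
Lemma pure_base_ubar n k :
  thetabar (ubar n.+1 k) = subword (ubar n) (k * (q n)%:Z)%R (q n).
Proof.
have [b tb] := u_block_range n.+1 k.
rewrite (ubarE tb) /pure_base tb.
rewrite -(subword_blk a0 (q0 n) (@thq n)).
rewrite -(morph_imageE (fun=> a0) q0 thq (u_fix n)).
have -> : (k * h%:Z * (q n)%:Z = k * (q n)%:Z * h%:Z)%R by ring.
rewrite mulnC (tau_subword (b0 n) h0 (@taubar_inj n))//.
exact: u_block_range.
Qed.

Lemma pure_base_length : constant_length thetabar q.
Proof.
move=> n b.
(* Every letter is some [ubar n.+1 k], because [taubar b] is a block of [u n.+1]. *)
have [/(_ b I) [k tb] _ _] := taubar_bij n.+1; rewrite PoszM in tb.
by rewrite -(ubarE tb) pure_base_ubar size_subword.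
Qed.

Lemma ubar_fix n : ubar n = blk (b0 n) (q n) (@thetabar n) (ubar n.+1).
Proof.
apply/funext => i; have [k [r [rq ->]]] := block_index (q0 n) i.
rewrite blkE// -(nth_subword (b0 n) (ubar n) _ rq).
by rewrite -pure_base_ubar.
Qed.

Lemma theta_comp_pure_base n k j :
  theta_comp thetabar (ubar (k + n) (Posz j)) =
  subword (ubar n) (j * \prod_(i < k) q (i + n))%:Z (\prod_(i < k) q (i + n)).
Proof.
have := @morph_theta_comp _ b0 thetabar q ubar q0 pure_base_length n k j 1 ubar_fix.
by move=> /=; rewrite mul1n => <-; rewrite /subword /= addr0 morph_word1.
Qed.

Lemma blk_ubar n : G n (ubar n) = u n.
Proof. exact: unblkK h0 (@taubar_inj n) _ (@u_block_range n). Qed.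

(** Forwards, every letter occurs in some [ubar], so windows of [y] are windows of [ubar n], and
    [G n] sends them to windows of [u n] at multiples of [h]. Backwards, density places each run of
    blocks of [G n y] in [u n] at a multiple of [h], and injectivity of [taubar] reads it as a
    window of [ubar n]. *)
Lemma mem_pure_base n c y : clock h (X n) c ->
  Xbar n y <-> base (X n) c (u n) (G n y).
Proof.
move=> cX; have szt := @size_taubar n; split=> [Xy|bGy i l].
- apply: (base_blk_limit h0 (@shift_space_closed _ theta n)
    (@shift_space_shz _ theta n) cX (u_mem n)) => m.
  have [k [b [_]]] := Xy (- m%:Z)%R m.*2.
  have [/(_ b I) [j tb] _ _] := taubar_bij (k + n); rewrite PoszM in tb.
  rewrite -(ubarE tb) theta_comp_pure_base.
  move=> /infix_subword; rewrite size_subword => -[r _ E].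
  exists (j * \prod_(i < k) q (i + n) + r).
  rewrite -(blk_ubar n) !PoszM -mulNr !(subword_blk a0 h0 szt) E.
  by rewrite PoszD.
- have bu : base (X n) c (u n) (u n) by split.
  have := base_dense (@shift_space_closed _ theta n) (mX n)
    (@shift_space_shz _ theta n) cX (l * h) bu
    (base_shz (@shift_space_shz _ theta n) cX i bGy).
  move=> [k]; rewrite subword_shz add0r -(blk_ubar n) PoszM.
  rewrite !(subword_blk a0 h0 szt) => /(morph_word_inj h0 szt (@taubar_inj n)) E.
  (* [K] is taken so large that the image of the single letter at index 0 of level [K + n] covers
     the first [k + l] letters of [ubar n]. *)
  have [K K0 KQ] := prod_unbounded n (k + l) q0 q1.
  exists K, (ubar (K + n) 0%R); split=> //.
  rewrite theta_comp_pure_base -E mul0n; apply: subword_infix => //.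
  by rewrite add0r -PoszD lez_nat ltnW.
Qed.

Lemma ubar_mem n : Xbar n (ubar n).
Proof.
have [c cX] := clock_exists n; apply/(mem_pure_base _ cX).
by rewrite blk_ubar.
Qed.

Lemma pure_base_minimal n : minimal (Xbar n) sigma.
Proof.
have [c cX] := clock_exists n.
apply: minimal_of_dense => [|y z U]; first by exists (ubar n); exact: ubar_mem.
apply: (@unblk_dense _ _ a0 (b0 n) h (@taubar n) (X n) c (u n) h0
  (@shift_space_closed _ theta n) (mX n) (@shift_space_shz _ theta n) cX
  (taubar_bij n)).
by move=> w; move/(mem_pure_base _ cX).
Qed.

(** The lengths are unchanged, so their conditions carry over; a period [p] of [y] would give the
    period [p * h] of its image in X^(0). *)
Lemma pure_base_torsion_free :
  aperiodic (X 0) sigma ->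
  (forall p k, prime p -> p %| q k -> forall N, exists2 n, N <= n & p %| q n) ->
  torsion_free thetabar.
Proof.
move=> apX qp; split.
  by move=> n b; rewrite -size_eq0 pure_base_length -lt0n.
exists q; split=> //; [exact: pure_base_length|exact: pure_base_minimal|].
move=> y p Xy p0 per; have [c cX] := clock0.
have [XGy _] := (mem_pure_base _ cX).1 Xy.
have p0' : 0 < p * h by rewrite muln_gt0 p0.
apply: (apX _ _ XGy p0').
by rewrite iter_sigma PoszM -(blk_shz a0 (@taubar 0) h0) -iter_sigma per.
Qed.

(** At every level the letters inject into the words of length [h] over the one alphabet [A]. *)
Lemma pure_base_bounded : bounded_alphabets B.
Proof.
exists #|{: h.-tuple A}| => n.
pose f (b : B n) : h.-tuple A := Tuple (introT eqP (size_taubar b)).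
by apply: (@leq_card _ _ f) => b b' /(congr1 val) /taubar_inj.
Qed.

End PureBase.

(** * The conjugacy with the tower *)

Lemma within_continuous_cst (U V : topologicalType) (X : set U) (v : V) :
  {within X, continuous (fun=> v)}.
Proof. by apply: continuous_subspaceT => x; exact: cvg_cst. Qed.

Lemma within_continuous_pair (U V W : topologicalType) (X : set U)
    (f : U -> V) (g : U -> W) :
  {within X, continuous f} -> {within X, continuous g} ->
  {within X, continuous (fun x => (f x, g x))}.
Proof.
move=> /within_continuousP cf /within_continuousP cg.
apply/within_continuousP => x Xx E [[P Q] [/= nP nQ] PQE].
apply: filterS2 (cf x Xx P nP) (cg x Xx Q nQ) => y fy gy Xy.
by apply: PQE; split; [exact: fy|exact: gy].
Qed.

(** Slices over a discrete factor are open, so continuity may be tested on each of them. *)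
Lemma within_continuous_discrete (U V : topologicalType)
    (K : discreteTopologicalType) (X : set U) (J : set K) (g : U * K -> V) :
  (forall k, J k -> {within X, continuous (fun x => g (x, k))}) ->
  {within X `*` J, continuous g}.
Proof.
move=> cg; apply/within_continuousP => -[x k] [/= Xx Jk] E nE.
have := (within_continuousP _ _).1 (cg k Jk) x Xx E nE => nP.
exists ([set y | X y -> E (g (y, k))], [set k]); first split=> //=.
  exact/nbhs_discreteE.
by move=> [y _] [/= Ey ->] [Xy _]; exact: Ey.
Qed.

Section Conjugacy.
Variables (A B : finType) (a0 : A) (b0 : B) (h : nat) (t : B -> seq A).
Variables (X : set (fullshift A)) (c : fullshift A -> nat) (u : fullshift A).
Variable (Y : set (fullshift B)).
Hypotheses (h0 : 0 < h) (th : forall b, size (t b) = h) (tinj : injective t).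
Hypotheses (shX : forall j x, X x -> X (shz j x)) (cX : clock h X c) (Xu : X u).
Local Notation G := (blk a0 h t).
Local Notation F := (unblk b0 h t).
Hypothesis YE : forall y, Y y <-> base X c u (G y).
Hypothesis block_range_base : forall x, base X c u x -> block_range h t x.

(* The level of the tower at [x], that is [c x - c u] modulo [h]. *)
Definition phase (x : fullshift A) : nat := (c x + (h - c u)) %% h.

Definition to_tower (x : fullshift A) : fullshift B * nat :=
  (F (shz (- (phase x)%:Z)%R x), phase x).

Definition of_tower (z : fullshift B * nat) : fullshift A :=
  shz z.2%:Z (G z.1).

Let clt x : X x -> c x < h. Proof. by move=> /cX[]. Qed.

Lemma base_phase x : X x -> base X c u (shz (- (phase x)%:Z)%R x).
Proof.
move=> Xx; set z := shz _ x; have Xz : X z by exact: shX.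
split=> //; have := clock_shz_nat shX cX (phase x) Xz.
rewrite shzD subrr shz0 /phase modnDmr => E.
(* [h - c u] stands for [- c u] modulo [h]; the truncated subtraction is exact because [c u < h]. *)
have cu := clt Xu; have cud : c u + (c x + (h - c u)) = c x + h by lia.
apply/eqP; rewrite -(modn_small (clt Xz)) -(modn_small cu).
rewrite -(eqn_modDr (c x + (h - c u))) cud modnDr -E modn_small//; exact: clt.
Qed.

Lemma of_towerK z : tower h Y z -> to_tower (of_tower z) = z.
Proof.
case: z => y i [/= Yy ih]; have [XGy cGy] := (YE y).1 Yy.
have p : phase (of_tower (y, i)) = i.
  rewrite /phase /of_tower /= (clock_shz_nat shX cX _ XGy) cGy modnDml.
  by rewrite addnAC subnKC ?(ltnW (clt Xu))// modnDl modn_small.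
by rewrite /to_tower p /of_tower /= shzD addrC subrr shz0 blkK.
Qed.

Lemma to_towerK x : X x -> of_tower (to_tower x) = x.
Proof.
move=> Xx; rewrite /of_tower /= unblkK ?shzD ?subrr ?shz0//.
exact/block_range_base/base_phase.
Qed.

Lemma to_tower_mem x : X x -> tower h Y (to_tower x).
Proof.
move=> Xx; split; last by rewrite /= ltn_mod.
by apply/YE; rewrite unblkK//; [|apply: block_range_base]; exact: base_phase.
Qed.

Lemma of_tower_mem z : tower h Y z -> X (of_tower z).
Proof. by move=> [/YE[Xz _] _]; exact: shX. Qed.

Lemma tower_map_mem z : tower h Y z -> tower h Y (tower_map h z).
Proof.
case: z => y i [/= Yy ih]; rewrite /tower_map /=; case: ifPn => /= ih'.
  by split=> //=; lia.
split=> //=; apply/YE; rewrite sigmaE (blk_shz _ _ h0); apply: base_shz => //.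
exact/YE.
Qed.

Lemma of_tower_map z : tower h Y z -> of_tower (tower_map h z) = sigma (of_tower z).
Proof.
case: z => y i [/= Yy ih]; rewrite /of_tower /tower_map /=; case: ifPn => /= ih'.
  by rewrite sigmaE shzD; congr (shz _ (G y)); lia.
rewrite !sigmaE (blk_shz _ _ h0) !shzD; congr (shz _ (G y)); lia.
Qed.

(** Transported from [of_tower_map] through the inverse, which avoids computing the phase of
    [sigma x]. *)
Lemma to_tower_sigma x : X x -> to_tower (sigma x) = tower_map h (to_tower x).
Proof.
move=> Xx; have tx := to_tower_mem Xx.
by rewrite -{1}(to_towerK Xx) -of_tower_map// of_towerK//; exact: tower_map_mem.
Qed.

Lemma to_tower_continuous : {within X, continuous to_tower}.
Proof.
have cph : {within X, continuous phase}.
  apply/within_continuousP => x Xx E nE; have [_ nc _] := cX Xx.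
  apply: filterS nc => y cy Xy; rewrite /phase cy//.
  exact: nbhs_singleton nE.
apply: within_continuous_pair => //.
(* The amount of the shift varies with [x]; factoring through pairs freezes it on each slice. *)
pose pr (x : fullshift A) := (x, phase x).
pose fz (z : fullshift A * nat) : fullshift B := F (shz (- z.2%:Z)%R z.1).
refine (@continuous_within_comp (fullshift A) (fullshift A * nat)%type
  (fullshift B) X (X `*` [set: nat]) pr fz _ _ _).
- by apply: within_continuous_pair => //; apply: continuous_subspaceT => x.
- apply: within_continuous_discrete => k _; apply: continuous_subspaceT => x.
  apply: continuous_comp; [exact: shz_continuous|exact: unblk_continuous].
- by move=> _ [x Xx <-].
Qed.

Lemma of_tower_continuous : {within tower h Y, continuous of_tower}.
Proof.
apply: within_continuous_discrete => k _; apply: continuous_subspaceT => y.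
apply: continuous_comp; [exact: blk_continuous|exact: shz_continuous].
Qed.

Lemma conjugate_tower : conjugate X sigma (tower h Y) (tower_map h).
Proof.
exists to_tower, of_tower; split.
- by split; [exact: to_tower_continuous|exact: of_tower_continuous].
- by split=> _ [x Xx <-]; [exact: to_tower_mem|exact: of_tower_mem].
- exact: to_towerK.
- exact: of_towerK.
- exact: to_tower_sigma.
Qed.

End Conjugacy.

(** * Suspensions of equicontinuous systems *)

Section Zpower.
Variables (V : Type) (Y : set V) (S S' : V -> V).
Hypothesis SK : forall y, Y y -> [/\ Y (S' y), S (S' y) = y & S' (S y) = y].
Hypothesis SY : forall y, Y y -> Y (S y).

Lemma zpower_mem n y : Y y -> Y (zpower S S' n y).
Proof.
move=> Yy; case: n => n /=; first by elim: n => //= n; exact: SY.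
have [Yn _ _] : [/\ Y (iter n S' y), True & True].
  by split=> //; elim: n => //= n /SK[].
by have [] := SK Yn.
Qed.

Lemma zpower_succ n y : Y y -> S (zpower S S' n y) = zpower S S' (n + 1)%R y.
Proof.
move=> Yy; case: n => [n|[|n]].
- by rewrite (_ : (n%:Z + 1)%R = n.+1); last by lia.
- by rewrite /=; have [] := SK Yy.
- rewrite (_ : (Negz n.+1 + 1)%R = Negz n); last by lia.
  rewrite [zpower _ _ (Negz n.+1) y]iterS.
  by have [] := SK (zpower_mem (Negz n) Yy).
Qed.

Lemma zpower_pred n y : Y y -> S' (zpower S S' n y) = zpower S S' (n - 1)%R y.
Proof.
move=> Yy; have Ym := zpower_mem (n - 1)%R Yy; have [_ _ E] := SK Ym.
by rewrite -{1}(subrK 1%R n) -zpower_succ.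
Qed.

End Zpower.

(** The analogue of [tower_map] over an arbitrary base system. *)
Definition suspension (V : Type) (h : nat) (S : V -> V) (z : V * nat) : V * nat :=
  if z.2 < h.-1 then (z.1, z.2.+1) else (S z.1, 0).

Lemma hausdorff_prod_nat (V : topologicalType) :
  hausdorff_space V -> hausdorff_space (V * nat)%type.
Proof.
move=> hV [p i] [q j] cl; congr (_, _).
- apply: hV => P Q nP nQ.
  have [||[x k] [/= [Px _] [Qx _]]] := cl (P `*` setT) (Q `*` setT).
  + by exists (P, setT) => //; split=> //; exact: filterT.
  + by exists (Q, setT) => //; split=> //; exact: filterT.
  + by exists x.
- have [||[x k] [/= [_ ->] [_ ->]]] := cl (setT `*` [set i]) (setT `*` [set j]) => //.
  + by exists (setT, [set i]) => //; split=> //; exact: filterT.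
  + by exists (setT, [set j]) => //; split=> //; exact: filterT.
Qed.

Section Suspension.
Variables (V : uniformType) (Y : set V) (S : V -> V) (h : nat).
Hypothesis h0 : 0 < h.
Local Notation T := (suspension h S).

Lemma suspension_dynamical :
  dynamical_system Y S -> dynamical_system (Y `*` `I_h) T.
Proof.
move=> [cY [y0 Yy0] cS [SY Sinj Ssurj]]; split.
- by apply: compact_setX => //; apply: finite_compact; exact: finite_II.
- by exists (y0, 0).
- apply: within_continuous_discrete => k _.
  have -> : (fun x => T (x, k)) =
      if k < h.-1 then (fun x => (x, k.+1)) else (fun x => (S x, 0)).
    by rewrite /suspension /=; case: ifP.
  case: (k < h.-1); first by apply: within_continuous_pair;
    apply: continuous_subspaceT => x //; exact: cvg_cst.
  by apply: within_continuous_pair => // x; exact: cvg_cst.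
- split.
  + move=> [y i] [/= Yy ih]; rewrite /suspension /=; case: ifP => ih' /=.
      by split=> //=; lia.
    by split=> //=; exact: SY.
  + move=> [y i] [z j]; rewrite !inE => -[/= Yy ih] [/= Yz jh].
    rewrite /suspension /=; do 2 case: ifPn => //= ?; case=> E.
    * by move=> ->; rewrite E.
    * by rewrite (Sinj y z) ?inE//; congr (_, _); lia.
  + move=> [y [|i]] [/= Yy ih].
      have [x Yx Sx] := Ssurj y Yy; exists (x, h.-1); first by split=> //=; lia.
      by rewrite /suspension /= ltnn Sx.
    exists (y, i); first by split=> //=; lia.
    by rewrite /suspension /= (_ : i < h.-1)//; lia.
Qed.

Lemma suspension_equicontinuous : (forall y, Y y -> Y (S y)) ->
  equicontinuous_system Y S -> equicontinuous_system (Y `*` `I_h) T.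
Proof.
move=> SY [S' [SK eqS]].
pose T' (z : V * nat) : V * nat :=
  if z.2 is i.+1 then (z.1, i) else (S' z.1, h.-1).
(* The exponent [m] and the level [j] depend only on [n] and [i], so two points of one level stay on
   a common level and are compared through a single power of [S]. *)
have TpowE n i : i < h -> exists m j, j < h /\
    forall y, Y y -> zpower T T' n (y, i) = (zpower S S' m y, j).
  move=> ih.
  have stepT m' j : j < h -> exists m j', j' < h /\
      forall y, Y y -> T (zpower S S' m' y, j) = (zpower S S' m y, j').
    move=> jh; case: (ltnP j h.-1) => jh'.
      exists m', j.+1; split=> [|y Yy]; first by lia.
      by rewrite /suspension /= jh'.
    exists (m' + 1)%R, 0; split=> // y Yy.
    by rewrite /suspension /= ltnNge jh' /= (zpower_succ SK SY).
  have stepT' m' j : j < h -> exists m j', j' < h /\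
      forall y, Y y -> T' (zpower S S' m' y, j) = (zpower S S' m y, j').
    case: j => [_|j jh]; last by exists m', j; split=> //; lia.
    exists (m' - 1)%R, h.-1; split=> [|y Yy]; first by lia.
    by rewrite /T' /= (zpower_pred SK SY).
  case: n => n /=; [elim: n => [|n IH]|elim: n => [|n IH]].
  - by exists 0%R, i.
  - have [m' [j [jh E]]] := IH; have [m [j' [jh' E']]] := stepT m' j jh.
    by exists m, j'; split=> // y Yy; rewrite iterS E// E'.
  - have [m [j [jh E]]] := stepT' 0%R i ih.
    by exists m, j; split=> // y Yy; rewrite -E.
  - have [m' [j [jh E]]] := IH; have [m [j' [jh' E']]] := stepT' m' j jh.
    by exists m, j'; split=> // y Yy; rewrite iterS E// E'.
exists T'; split.
  move=> [y i] [/= Yy ih]; have [Y'y SS' S'S] := SK _ Yy; split.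
  - by case: i ih => [|i] ih; split=> //=; lia.
  - case: i ih => [|i] ih; rewrite /suspension /= ?ltnn ?SS'//.
    by rewrite (_ : i < h.-1)//; lia.
  - rewrite /suspension /=; case: ifP => ih' //=; rewrite /T' /= S'S.
    by congr (_, _); lia.
move=> E [[E1 E2] [/= entE1 entE2] EE].
have [D1 entD1 D1P] := eqS _ entE1.
(* The uniformity of [nat] is discrete, so an entourage may force equal levels. *)
exists [set xy | D1 (xy.1.1, xy.2.1) /\ xy.1.2 = xy.2.2].
  exists (D1, [set xy | xy.1 = xy.2]).
    split=> //=; rewrite /= uniform_discrete.
    by move=> _ [x _ <-].
  move=> [[x1 y1] [x2 y2]] [/= D ->].
  by exists ((x1, y2), (y1, y2)).
move=> [x i] [y j] [/= Yx ih] [/= Yy _] [/= Dxy <-] n.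
have [m [k [_ Em]]] := TpowE n i ih; rewrite !Em//.
have [|[a b] Eab [e1 e2 e3 e4]] := EE ((zpower S S' m x, zpower S S' m y), (k, k)).
- split=> /=; [exact: D1P|exact: entourage_refl].
- by move: a b e1 e2 e3 e4 Eab => [a1 a2] [b1 b2] /= -> -> -> ->.
Qed.

End Suspension.

(** * Odometers *)

Section Odometer.
Variables (q : nat -> nat) (h : nat).
Hypotheses (h0 : 0 < h) (q0 : forall n, 0 < q n) (hq : forall n, coprime h (q n)).
Local Notation Q n := (qprod q n).
Local Notation Zq := {ptws nat -> nat}.

Lemma qprodS n : Q n.+1 = Q n * q n.
Proof. by rewrite /qprod big_ord_recr. Qed.

Lemma qprod_gt0 n : 0 < Q n.
Proof. by rewrite prodn_gt0. Qed.

Lemma coprime_qprod n : coprime (Q n) h.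
Proof.
elim: n => [|n IH]; first by rewrite /qprod big_ord0 coprime1n.
by rewrite qprodS coprimeMl IH coprime_sym hq.
Qed.

(** Multiplication by the element of the inverse limit with residues [k n]; a constant [k] is
    multiplication by an integer. *)
Definition odometer_mul (k : nat -> nat) (z : Zq) : Zq :=
  fun n => (k n * z n) %% Q n.

Lemma odometer_mul_continuous k : continuous (odometer_mul k).
Proof.
move=> z; apply: (@cvg_ptws_discrete _ _ _ (nbhs z)) => n.
have := near_coord n z.
by apply: (@filterS _ (nbhs z)) => y; rewrite /odometer_mul => ->.
Qed.

Lemma odometer_mul_mem k z : (forall n, k n.+1 = k n %[mod Q n]) ->
  odometer q z -> odometer q (odometer_mul k z).
Proof.
move=> kc oz n; split; first by rewrite ltn_mod qprod_gt0.
rewrite /odometer_mul modn_dvdm ?qprodS ?dvdn_mulr//.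
by rewrite -modnMml kc modnMml -modnMmr (oz n).2.
Qed.

(** [h] is a unit modulo each product [Q n], and uniqueness of the inverse modulo [Q n] makes the
    chosen residues compatible. *)
Lemma odometer_inverse : exists r : nat -> nat,
  (forall n, r n * h = 1 %[mod Q n]) /\ (forall n, r n.+1 = r n %[mod Q n]).
Proof.
have /choice[r rh] n : exists r, r * h = 1 %[mod Q n].
  by apply: modn_inverse => //; exact: coprime_qprod.
exists r; split=> // n.
have rh' : r n.+1 * h = 1 %[mod Q n].
  have dv : Q n %| Q n.+1 by rewrite qprodS dvdn_mulr.
  by rewrite -[LHS](modn_dvdm _ dv) rh modn_dvdm.
rewrite -[in LHS](muln1 (r n.+1)) -modnMmr -(rh n) modnMmr mulnCA.
by rewrite -modnMmr rh' modnMmr muln1.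
Qed.

Lemma odometer_mulK k l z : (forall n, k n * l n = 1 %[mod Q n]) ->
  odometer q z -> odometer_mul k (odometer_mul l z) = z.
Proof.
move=> kl oz; apply/funext => n; rewrite /odometer_mul modnMmr mulnA.
by rewrite -modnMml kl modnMml mul1n modn_small//; case: (oz n).
Qed.

Lemma iter_rotation k z i : odometer q z ->
  (iter k (rotation q h) (z, i)).1 = (fun n => (z n + k) %% Q n) :> Zq.
Proof.
move=> oz; elim: k => [|k IH]; apply/funext => n.
  by rewrite addn0 modn_small//; case: (oz n).
by rewrite iterS [LHS]/= IH -[(_ %% _).+1]addn1 modnDml addn1 addnS.
Qed.

Lemma rotation_continuous k l :
  {within rotation_space q k, continuous (rotation q l)}.
Proof.
apply: within_continuous_discrete => i _; apply: within_continuous_pair.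
  apply: continuous_subspaceT => z.
  apply: (@cvg_ptws_discrete _ _ _ (nbhs z)) => n.
  have H := near_coord n z.
  by apply: (@filterS _ (nbhs z) _ _ _ _ H) => y; rewrite /rotation /= => ->.
exact: (@within_continuous_cst {ptws nat -> nat} nat _ (i.+1 %% l)).
Qed.

Hypothesis dynh : dynamical_system (rotation_space q h) (rotation q h).

(** The first coordinate of a rotation involves neither the level nor its modulus, so injectivity on
    [h] levels, used at level 0, suffices. *)
Lemma rotation_inj (z w : Zq) i j k l : odometer q z -> odometer q w ->
  (rotation q k (z, i)).1 = (rotation q l (w, j)).1 -> z = w.
Proof.
move=> oz ow E; have [_ _ _ [_ inj _]] := dynh.
suff [] : (z, 0) = (w, 0) by [].
by apply: inj; rewrite ?inE// /rotation /=; congr (_, _).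
Qed.

(** Compactness and bijectivity are read off from the product with Z/h, where [dynh] supplies
    them. *)
Lemma rotation1_dynamical : dynamical_system (rotation_space q 1) (rotation q 1).
Proof.
have [cY [[z i] [oz _]] cR [RY Rinj Rsurj]] := dynh; split.
- rewrite (_ : rotation_space q 1 = (fun z => (z.1, 0)) @` rotation_space q h).
    apply: continuous_compact => //; apply: within_continuous_discrete => k _.
    by apply: within_continuous_pair; apply: continuous_subspaceT => x //; exact: cvg_cst.
  apply/seteqP; split=> [[y j] [/= oy]|_ [[y j] [/= oy _] <-]] //.
  by rewrite ltnS leqn0 => /eqP ->; exists (y, 0).
- by exists (z, 0).
- exact: rotation_continuous.
- split.
  + move=> [y j] [/= oy _]; have [] : rotation_space q h (rotation q h (y, 0)).
      exact: RY.
    by move=> oy' _; split=> //=; rewrite modn1.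
  + move=> [y j] [w k]; rewrite !inE => -[/= oy].
    rewrite ltnS leqn0 => /eqP -> [/= ow]; rewrite ltnS leqn0 => /eqP -> E.
    by rewrite (rotation_inj oy ow (congr1 fst E)).
  + move=> [y j] [/= oy]; rewrite ltnS leqn0 => /eqP ->.
    have [|[w k] [/= ow _] E] := Rsurj (y, 0); first by [].
    exists (w, 0) => //.
    by apply: injective_projections; [exact: (congr1 fst E)|exact: modn1].
Qed.

Lemma rotation1_equicontinuous :
  equicontinuous_system (rotation_space q h) (rotation q h) ->
  equicontinuous_system (rotation_space q 1) (rotation q 1).
Proof.
move=> [S [SK eqS]].
pose S1 (z : Zq * nat) : Zq * nat := ((S (z.1, 0)).1, 0).
have Smem z i : i < h -> odometer q z -> odometer q (S (z, i)).1.
  by move=> ih oz; have [[]] := SK (z, i) (conj oz ih).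
(* Injectivity of the rotation makes its inverse act on the first coordinate independently of the
   level. *)
have SE z i j : i < h -> j < h -> odometer q z -> (S (z, i)).1 = (S (z, j)).1.
  move=> ih jh oz; apply: (@rotation_inj _ _ (S (z, i)).2 (S (z, j)).2 h h).
  - exact: Smem.
  - exact: Smem.
  - have [_ + _] := SK (z, i) (conj oz ih); have [_ + _] := SK (z, j) (conj oz jh).
    by rewrite -!surjective_pairing => -> ->.
exists S1; split=> [[z i] [/= oz]|E entE].
  rewrite ltnS leqn0 => /eqP ->; have oS : odometer q (S (z, 0)).1 by exact: Smem.
  have [_ RS SR] := SK (z, 0) (conj oz h0); split=> //=.
    by apply: injective_projections; [exact: (congr1 fst RS)|exact: modn1].
  rewrite /S1 /rotation /=; congr (_, _).
  have oR : odometer q (rotation q h (z, 0)).1.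
    by have [_ _ _ [/(_ (z, 0) (conj oz h0))[]]] := dynh.
  rewrite -[RHS]/((z, 0).1) -SR /rotation /=.
  by apply: SE; rewrite ?ltn_mod.
have powE n z : odometer q z ->
    zpower (rotation q 1) S1 n (z, 0) = ((zpower (rotation q h) S n (z, 0)).1, 0).
  move=> oz; case: n => n.
    elim: n => [//|n /= ->]; rewrite /rotation /= modn1.
    by congr (_, _).
  have H m : [/\ iter m S1 (z, 0) = ((iter m S (z, 0)).1, 0),
      odometer q (iter m S (z, 0)).1 & (iter m S (z, 0)).2 < h].
    elim: m => [//|m [E1 om ih]]; rewrite !iterS E1.
    have [[]] := SK (iter m S (z, 0)) (conj om ih) => oS Sh _ _.
    split=> //; rewrite /S1 /=; congr (_, _).
    by rewrite [in RHS](surjective_pairing (iter m S (z, 0))); exact: SE.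
  by have [] := H n.+1.
pose pr (z : Zq * nat) : Zq * nat := (z.1, 0).
have [[E1 E2] [/= entE1 entE2] EE] := entE.
(* Pulling [E] back along [pr], which forgets the level, reduces the claim through [powE] to
   equicontinuity on [h] levels. *)
have entE' : entourage [set xy : (Zq * nat) * (Zq * nat) | E (pr xy.1, pr xy.2)].
  exists (E1, setT); first by split=> //; exact: filterT.
  move=> [[a b] [c d]] [/= Eab _].
  have [|[p1 p2] Ep [e1 e2 e3 e4]] := EE ((a, b), (0, 0)).
    by split=> //=; exact: entourage_refl.
  exists ((a, c), (b, d)) => //=; move: p1 p2 e1 e2 e3 e4 Ep => [? ?] [? ?] /=.
  by move=> <- <- -> ->.
have [D entD DP] := eqS _ entE'.
exists D => // -[z i] [w j] [/= oz]; rewrite ltnS leqn0 => /eqP ->.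
move=> [/= ow]; rewrite ltnS leqn0 => /eqP -> Dzw n.
by rewrite !powE//; exact: (DP (z, 0) (w, 0)).
Qed.

End Odometer.

(** * The height of the pure base *)

Lemma factor_clock (A : finType) (X : set (fullshift A)) q h
    (pi : fullshift A -> {ptws nat -> nat} * nat) :
  factor_map X sigma (rotation_space q h) (rotation q h) pi ->
  clock h X (fun x => (pi x).2).
Proof.
move=> [cpi piX pis] x Xx.
have [_ ch] : rotation_space q h (pi x) by rewrite -piX; exists x.
split=> //; last by rewrite pis.
apply: ((within_continuousP _ _).1 cpi x Xx [set z | z.2 = (pi x).2]).
exists (setT, [set (pi x).2]); last by move=> z [].
by split=> /=; [exact: filterT|exact/nbhs_discreteE].
Qed.

Section HeightOne.
Variables (A B : finType) (a0 : A) (b0 : B) (h : nat) (t : B -> seq A).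
Variables (X : set (fullshift A)) (u : fullshift A) (Y : set (fullshift B)).
Variables (q : nat -> nat) (pi : fullshift A -> {ptws nat -> nat} * nat).
Local Notation c := (fun x => (pi x).2).
Local Notation G := (blk a0 h t).
Local Notation F := (unblk b0 h t).
Hypotheses (h0 : 0 < h) (th : forall b, size (t b) = h) (tinj : injective t).
Hypotheses (q0 : forall n, 0 < q n) (hq : forall n, coprime h (q n)).
Hypotheses (shX : forall j x, X x -> X (shz j x)) (Xu : X u).
Hypothesis YE : forall y, Y y <-> base X c u (G y).
Hypothesis block_range_base : forall x, base X c u x -> block_range h t x.
Hypothesis pi_factor :
  equicontinuous_factor X sigma (rotation_space q h) (rotation q h) pi.
Hypothesis pi_max : forall (W : uniformType) (Z : set W) (R : W -> W)
    (rho : fullshift A -> W),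
  equicontinuous_factor X sigma Z R rho ->
  exists p, factor_map (rotation_space q h) (rotation q h) Z R p /\
    forall x, X x -> p (pi x) = rho x.

Let pi_map : factor_map X sigma (rotation_space q h) (rotation q h) pi.
Proof. by case: pi_factor. Qed.

Let cX : clock h X c.
Proof. exact: factor_clock pi_map. Qed.

Let pi_mem x : X x -> rotation_space q h (pi x).
Proof. by have [_ <- _] := pi_map => Xx; exists x. Qed.

Let Ysig y : Y y -> Y (sigma y).
Proof.
move=> /YE Gy; apply/YE; rewrite sigmaE (blk_shz _ _ h0).
exact: (base_shz shX cX).
Qed.

Lemma pi_blk_sigma y n : Y y ->
  (pi (G (sigma y))).1 n = ((pi (G y)).1 n + h) %% qprod q n.
Proof.
move=> /YE[XGy _]; have [_ _ pis] := pi_map.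
have piI k : pi (iter k sigma (G y)) = iter k (rotation q h) (pi (G y)).
  elim: k => [//|k IH]; rewrite !iterS pis ?IH// iter_sigma; exact: shX.
rewrite sigmaE (blk_shz _ _ h0) mul1r -iter_sigma piI (surjective_pairing (pi _)).
by rewrite iter_rotation//; case: (pi_mem XGy).
Qed.

Variable r : nat -> nat.
Hypotheses (rh : forall n, r n * h = 1 %[mod qprod q n])
  (rc : forall n, r n.+1 = r n %[mod qprod q n]).

(* [sigma] on [Y] is [sigma^h], which acts on the odometer as addition of [h];
   dividing by [h] turns this into addition of 1. *)
Definition pi_base (y : fullshift B) : {ptws nat -> nat} * nat :=
  (odometer_mul q r (pi (G y)).1, 0).

Lemma pi_base_sigma y : Y y -> pi_base (sigma y) = rotation q 1 (pi_base y).
Proof.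
move=> Yy; rewrite /rotation; apply: injective_projections => /=; last by rewrite modn1.
apply/funext => n; rewrite /odometer_mul pi_blk_sigma//.
rewrite modnMmr mulnDr -modnDmr rh modnDmr addn1 -[in RHS]addn1 modnDml.
by rewrite addn1.
Qed.

Lemma pi_base_continuous : {within Y, continuous pi_base}.
Proof.
have [cpi _ _] := pi_map.
apply: within_continuous_pair; last first.
  exact: within_continuous_cst.
apply: (@continuous_within_comp _ _ _ Y X G (fun x => odometer_mul q r (pi x).1)).
- by apply: continuous_subspaceT; exact: blk_continuous.
- apply: (@continuous_within_comp _ _ _ X (rotation_space q h) pi
    (fun z => odometer_mul q r z.1)) => //.
  + apply: continuous_subspaceT => z.
    apply: (@continuous_comp _ _ _ (fun z : {ptws nat -> nat} * nat => z.1)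
      (odometer_mul q r)); [exact: cvg_fst|exact: odometer_mul_continuous].
  + by move=> _ [x Xx <-]; exact: pi_mem.
- by move=> _ [y /YE[XGy _] <-].
Qed.

Lemma pi_base_image : pi_base @` Y = rotation_space q 1.
Proof.
apply/seteqP; split=> [_ [y /YE[XGy _] <-]|[z i] [/= oz]].
  by split=> //=; apply: odometer_mul_mem => //; case: (pi_mem XGy).
rewrite ltnS leqn0 => /eqP ->; have [_ piX _] := pi_map.
have ohz : odometer q (odometer_mul q (fun=> h) z) by exact: odometer_mul_mem.
(* The preimage is sought over the clock value of [u], which puts it in [base]; the first coordinate
   [h z] compensates the later multiplication by [r]. *)
have [x Xx pix] : (pi @` X) (odometer_mul q (fun=> h) z, (pi u).2).
  by rewrite piX; split=> //=; case: (pi_mem Xu).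
have bx : base X c u x by split=> //=; rewrite pix.
have GFx := unblkK a0 b0 h0 tinj (block_range_base bx).
exists (F x); first by apply/YE; rewrite GFx.
by rewrite /pi_base GFx pix /= odometer_mulK.
Qed.

Let of_tw := of_tower a0 h t.
Let to_tw := to_tower b0 h t c u.

Let of_twK z : tower h Y z -> to_tw (of_tw z) = z.
Proof. exact: (of_towerK b0 h0 th tinj shX cX Xu YE). Qed.

Let to_tw_sigma x : X x -> to_tw (sigma x) = tower_map h (to_tw x).
Proof. exact: (to_tower_sigma b0 h0 th tinj shX cX Xu YE block_range_base). Qed.

(** [X] is the tower of height [h] over [Y], so [rho] applied level by level is a factor map onto
    the suspension of [R], to which the maximality of [pi] applies. *)
Lemma suspended_factor (W : uniformType) (Z : set W) (R : W -> W)
    (rho : fullshift B -> W) : equicontinuous_factor Y sigma Z R rho ->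
  equicontinuous_factor X sigma (Z `*` `I_h) (suspension h R)
    (fun x => (rho (to_tw x).1, (to_tw x).2)).
Proof.
move=> [hW dynZ eqZ [crho rhoY rhos]].
have RZ z : Z z -> Z (R z) by have [_ _ _ [RZ _ _]] := dynZ; exact: RZ.
have cto : {within X, continuous to_tw} by exact: (to_tower_continuous cX).
have tomem x : X x -> tower h Y (to_tw x).
  exact: (to_tower_mem b0 h0 tinj shX cX Xu YE block_range_base).
split.
- exact: hausdorff_prod_nat.
- exact: suspension_dynamical.
- exact: suspension_equicontinuous.
split.
- apply: (@continuous_within_comp _ _ _ X (tower h Y) to_tw
    (fun z : fullshift B * nat => (rho z.1, z.2))) => //.
  + apply: within_continuous_discrete => k _.
    by apply: within_continuous_pair => //; exact: within_continuous_cst.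
  + by move=> _ [x Xx <-]; exact: tomem.
- apply/seteqP; split=> [_ [x Xx <-]|[z i] [/= Zz ih]].
    by have [Yx ih] := tomem x Xx; split=> //=; rewrite -rhoY; exists (to_tw x).1.
  move: Zz; rewrite -rhoY => -[y Yy <-].
  have ty : tower h Y (y, i) by split.
  exists (of_tw (y, i)); first exact: (of_tower_mem shX YE).
  exact: (congr1 (fun z => (rho z.1, z.2)) (of_twK ty)).
- move=> x Xx; have [Yx _] := tomem x Xx.
  by rewrite to_tw_sigma// /tower_map /suspension /=; case: ifP => //= _; rewrite rhos.
Qed.

Lemma base_max_equicontinuous_factor :
  max_equicontinuous_factor Y sigma (rotation_space q 1) (rotation q 1).
Proof.
have [hV dynh eqh _] := pi_factor.
exists pi_base; split.
  split=> //; [exact: (rotation1_dynamical h0)|exact: (rotation1_equicontinuous h0)|].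
  split; [exact: pi_base_continuous|exact: pi_base_image|exact: pi_base_sigma].
move=> W Z R rho rhof; have [_ _ _ [crho rhoY rhos]] := rhof.
have [p [[cp pZ ps] prho]] := pi_max (suspended_factor rhof).
(* [lift] recovers [pi (G y)] from [pi_base y]: multiplying by [h] undoes [r], and the clock value
   on [base] is that of [u]. *)
pose lift (z : {ptws nat -> nat} * nat) := (odometer_mul q (fun=> h) z.1, (pi u).2).
have prE y : Y y -> (p (lift (pi_base y))).1 = rho y.
  move=> Yy; have /YE[XGy cGy] := Yy.
  have -> : lift (pi_base y) = pi (G y).
    apply: injective_projections; last exact: esym cGy.
    rewrite /= odometer_mulK//; last by case: (pi_mem XGy).
    by move=> n; rewrite mulnC.
  have ty : tower h Y (y, 0) by split.
  have -> : G y = of_tw (y, 0) by rewrite /of_tw /of_tower shz0.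
  rewrite prho; last exact: (of_tower_mem shX YE ty).
  exact: (congr1 (fun z => rho z.1) (of_twK ty)).
exists (fun z => (p (lift z)).1); split=> //; split.
- apply: (@continuous_within_comp _ _ _ _ (rotation_space q h) lift (fun z => (p z).1)).
  + apply: within_continuous_pair; last exact: within_continuous_cst.
    apply: continuous_subspaceT => z.
    apply: (@continuous_comp _ _ _ (fun z : {ptws nat -> nat} * nat => z.1)
      (odometer_mul q (fun=> h))); [exact: cvg_fst|exact: odometer_mul_continuous].
  + apply: (@continuous_within_comp _ _ _ _ (Z `*` `I_h) p fst) => //.
      by apply: continuous_subspaceT => z; exact: cvg_fst.
    by rewrite pZ.
  + move=> _ [z [oz _] <-]; split; last by case: (pi_mem Xu).
    exact: odometer_mul_mem.
(* Every point of the one-level rotation is some [pi_base y], so the image and the equivariance both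
   follow from [prE]. *)
- rewrite -pi_base_image -rhoY; apply/seteqP; split=> [_ [_ [y Yy <-] <-]|_ [y Yy <-]].
    by exists y => //; rewrite prE.
  by exists (pi_base y); [exists y|rewrite prE].
- rewrite -pi_base_image => _ [y Yy <-].
  by rewrite -pi_base_sigma// !prE ?rhos//; exact: Ysig.
Qed.

End HeightOne.

Theorem theorem31 (A : finType) (theta : dirseq (fun _ : nat => A)) (h : nat)
    (theta_tf : torsion_free theta) (theta_h : is_height theta h)
    (u : nat -> fullshift A)
    (u_mem : forall n, shift_space theta n (u n))
    (u_fix : forall n, morph_image (theta n) (u n.+1) (u n))
    (B : nat -> finType) (taubar : forall n, B n -> seq A)
    (taubar_bij : forall n,
       set_bij [set: B n]%classic (block_words h (u n)) (taubar n)) :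
  let thetabar := pure_base theta h taubar in
  [/\ torsion_free thetabar,
      is_height thetabar 1 &
      conjugate (shift_space theta 0) sigma
        (tower h (shift_space thetabar 0)) (tower_map h)].
Proof.
move=> thetabar; set a0 := u 0 0%R.
have [_ _ h0 [q [thq hq [pi [pi_factor pi_max]]]]] := theta_h.
have [ne [q' [thq' q1 mX apX qp]]] := theta_tf.
(* Both sequences record the lengths of the same images, and the letter [a0] witnesses a non-empty
   alphabet. *)
have q'E : q' = q by apply/funext => n; rewrite -(thq' n a0) thq.
rewrite {}q'E in thq' q1 qp.
have q0 n : 0 < q n by rewrite -(thq n a0) lt0n size_eq0.
have pi_map : factor_map (shift_space theta 0) sigma
    (rotation_space q h) (rotation q h) pi by case: pi_factor.
have cX := factor_clock pi_map.
have cex : exists c, clock h (shift_space theta 0) c by eexists; exact: cX.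
have size_t := size_taubar taubar_bij; have inj_t := taubar_inj taubar_bij.
have shX := @shift_space_shz _ theta 0.
have YE y := mem_pure_base h0 q0 thq hq q1 mX u_mem u_fix taubar_bij cex y cX.
have range := base_block_range (@shift_space_closed _ theta 0) (mX 0) shX cX
  (u_mem 0) (taubar_bij 0).
(* A letter of [B 0] to serve as the default of [unblk]. *)
have [b _] := block_exists taubar_bij 0.
have tf : torsion_free thetabar by exact: (pure_base_torsion_free h0 q0 thq hq q1).
split=> //.
- split=> //; first exact: (pure_base_bounded taubar_bij).
  exists q; split.
  + exact: (pure_base_length h0 q0 thq hq mX u_mem u_fix taubar_bij cex).
  + by move=> n; exact: coprime1n.
  + have [r [rh rc]] := odometer_inverse h0 hq.
    exact: (base_max_equicontinuous_factor b h0 (@size_t 0) (@inj_t 0) q0 shX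
      (u_mem 0) YE range pi_factor pi_max rh rc).
- exact: (conjugate_tower b h0 (@size_t 0) (@inj_t 0) shX cX (u_mem 0) YE range).
Qed.
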